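(* Let $(X,d)$ be a metric space and let $\phi$ be the weak asymptotic resemblance induced by the metric $d$. Then for all nonempty $A,B\subseteq X$, we have $A\,\phi\,B$ if and only if $A$ and $B$ have finite Hausdorff distance.
   Context: For subsets $A,B$ of a metric space $(X,d)$ put $d(A,B)=\inf\{d(x,y)\mid x\in A, y\in B\}$, with $\inf\emptyset=\infty$. Write $A\,\mathbf{b}\,B$ ($A$ and $B$ are coarsely close) if there exists $\epsilon<\infty$ such that for all bounded sets $D\subseteq X$, $d(A\setminus D,B\setminus D)<\epsilon$. The weak asymptotic resemblance $\phi$ induced by $d$ is the relation on the power set of $X$ given by: $A\,\phi\,B$ if and only if $A\,\mathbf{b}\,B'$ for every unbounded $B'\subseteq B$, and $A'\,\mathbf{b}\,B$ for every unbounded $A'\subseteq A$ (unbounded with respect to $d$). The Hausdorff distance is $d_H(A,B)=\inf\{\epsilon\mid A\subseteq\mathscr{B}(B,\epsilon)\text{ and }B\subseteq\mathscr{B}(A,\epsilon)\}$, where $\mathscr{B}(A,\epsilon)=\bigcup_{x\in A}\mathscr{B}(x,\epsilon)$ is the union of open balls of radius $\epsilon$ centered at points of $A$ (and $\inf\emptyset=\infty$). *)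

(* Defs.v *)
From mathcomp Require Import all_boot all_order all_algebra.
From mathcomp Require Export boolp classical_sets reals constructive_ereal ereal.
From mathcomp Require Export topology.

Set Implicit Arguments.
Unset Strict Implicit.
Unset Printing Implicit Defensive.

Import Order.TTheory GRing.Theory Num.Theory.

Local Open Scope classical_set_scope.
Local Open Scope ring_scope.

Definition metric_bounded (R : realType) (X : metricType R) (D : set X) : Prop :=
  exists M : R, forall x y, D x -> D y -> mdist x y <= M.

(* Equals +oo when A or B is empty. *)
Definition set_dist (R : realType) (X : metricType R) (A B : set X) : \bar R :=
  ereal_inf [set (mdist x y)%:E | x in A & y in B].

Definition coarsely_close (R : realType) (X : metricType R) (A B : set X) : Prop :=
  exists e : R, forall D : set X, metric_bounded D ->
    (set_dist (A `\` D) (B `\` D) < e%:E)%E.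

Definition weak_asymptotic_resemblance (R : realType) (X : metricType R)
    (A B : set X) : Prop :=
  (forall B' : set X, B' `<=` B -> ~ metric_bounded B' -> coarsely_close A B') /\
  (forall A' : set X, A' `<=` A -> ~ metric_bounded A' -> coarsely_close A' B).

(* [ball x e] is the open ball [set y | mdist x y < e], by [ballEmdist]. *)
Definition set_ball (R : realType) (X : metricType R) (A : set X) (e : R) : set X :=
  \bigcup_(x in A) ball x e.

(* The constraint 0 < e is automatic as soon as A or B is nonempty. *)
Definition hausdorff_dist (R : realType) (X : metricType R) (A B : set X) : \bar R :=
  ereal_inf [set e%:E | e in
    [set e : R | 0 < e /\ A `<=` set_ball B e /\ B `<=` set_ball A e]].

(* Main.v *)
(** If [A] is contained in no neighbourhood of [B], choose [u n] in [A] at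
    distance at least [n] from [B]. The set [A'] of all [u n] is unbounded, but
    deleting the bounded set of its first [n] terms leaves a set at distance at
    least [n] from [B], so [A'] and [B] are not coarsely close. Conversely, an
    unbounded subset of [B] has points at distance at least [e] from any given
    bounded set [D]; when [B] lies in the [e]-neighbourhood of [A], such a point
    is [e]-close to a point of [A], which then lies outside [D] as well. *)
Require Import Defs.
From mathcomp Require Import all_boot all_order all_algebra.
From mathcomp Require Import classical_sets reals constructive_ereal ereal topology.
From mathcomp Require Import boolp lra.

Import Order.TTheory GRing.Theory Num.Theory.

Local Open Scope classical_set_scope.
Local Open Scope ring_scope.

Lemma set_dist_ltP {R : realType} {X : metricType R} {A B : set X} {e : R} :
  (set_dist A B < e%:E)%E <->
  exists x y, [/\ A x, B y & mdist x y < e].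
Proof.
split=> [/ereal_inf_ltP[_ [x Ax [y By <-]]]|[x [y [Ax By xy]]]].
  by rewrite lte_fin => xy; exists x, y.
by apply/ereal_inf_ltP; exists (mdist x y)%:E; [exists x => //; exists y|].
Qed.

Lemma coarsely_closeC {R : realType} {X : metricType R} {A B : set X} :
  coarsely_close A B -> coarsely_close B A.
Proof.
move=> [e AB]; exists e => D /AB/set_dist_ltP[x [y [Ax By xy]]].
by apply/set_dist_ltP; exists y, x; rewrite metric_sym.
Qed.

Lemma set_ballP {R : realType} {X : metricType R} {A : set X} {e : R} {y : X} :
  set_ball A e y <-> exists2 x, A x & mdist x y < e.
Proof. by split=> -[x Ax xy]; exists x; rewrite ?ballEmdist // in xy *. Qed.

Lemma set_ball_le {R : realType} {X : metricType R} {A : set X} {e f : R} :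
  e <= f -> set_ball A e `<=` set_ball A f.
Proof.
move=> ef y /set_ballP[x Ax xy]; apply/set_ballP.
by exists x => //; exact: lt_le_trans ef.
Qed.

Lemma hausdorff_dist_ltyP {R : realType} {X : metricType R} {A B : set X} :
  (hausdorff_dist A B < +oo)%E <->
  exists e : R, [/\ 0 < e, A `<=` set_ball B e & B `<=` set_ball A e].
Proof.
split=> [/ereal_inf_ltP[_ [e [e0 [AB BA]] <-] _]|[e [e0 AB BA]]].
  by exists e.
by apply/ereal_inf_ltP; exists e%:E; [exists e|rewrite ltry].
Qed.

(** Otherwise each point of [B] is within [r] of [D], and passing through [D] bounds the diameter of
    [B] by [r + M + r]. *)
Lemma unbounded_far {R : realType} {X : metricType R} {B D : set X} (r : R) :
  ~ metric_bounded B -> metric_bounded D ->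
  exists2 b, B b & forall x, D x -> r <= mdist b x.
Proof.
move=> nB [M DM]; apply: contrapT => near; apply: nB.
have close b : B b -> exists2 x, D x & mdist b x < r.
  move=> Bb; apply: contrapT => far; apply: near; exists b => // x Dx.
  by rewrite leNgt; apply/negP => bx; apply: far; exists x.
exists (r + M + r) => b c /close[x Dx bx] /close[y Dy cy].
have := metric_triangle b x c; have := metric_triangle x y c.
have := DM x y Dx Dy; rewrite (metric_sym y c); lra.
Qed.

Lemma coarsely_close_unbounded {R : realType} {X : metricType R}
    {A B B' : set X} {e : R} :
  0 < e -> B `<=` set_ball A e -> B' `<=` B -> ~ metric_bounded B' ->
  coarsely_close A B'.
Proof.
move=> e0 BA B'B nB'; exists e => D bD.
have [b B'b far] := unbounded_far e nB' bD.
have /set_ballP[a Aa ab] := BA b (B'B b B'b).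
apply/set_dist_ltP; exists a, b; split=> //; split=> //.
(* Being at distance at least [e] from all of [D], [b] rules out [a] in [D] because [mdist a b < e],
   and [b] in [D] because [mdist b b = 0 < e]. *)
- by move=> /far; rewrite metric_sym leNgt ab.
- by move=> /far; rewrite mdistxx leNgt e0.
Qed.

Lemma metric_bounded_prefix {R : realType} {X : metricType R} (u : nat -> X)
    (n : nat) :
  metric_bounded [set u k | k in [set k | (k < n)%N]].
Proof.
(* A sum of nonnegative distances stands in for their maximum. *)
pose S := \sum_(i < n) mdist (u 0%N) (u i).
have uS k : (k < n)%N -> mdist (u 0%N) (u k) <= S.
  move=> kn; rewrite /S (bigD1 (Ordinal kn)) //= lerDl.
  by apply: sumr_ge0 => i _; exact: mdist_ge0.
exists (S + S) => _ _ [i /uS iS <-] [j /uS jS <-].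
have := metric_triangle (u i) (u 0%N) (u j); rewrite (metric_sym (u i) (u 0%N)); lra.
Qed.

(** For empty [B] and bounded nonempty [A] the closeness hypothesis is vacuous and the conclusion
    fails, hence the point [b]. *)
Lemma coarsely_close_sub_set_ball {R : realType} {X : metricType R}
    {A B : set X} :
  B !=set0 ->
  (forall A', A' `<=` A -> ~ metric_bounded A' -> coarsely_close A' B) ->
  exists2 e : R, 0 < e & A `<=` set_ball B e.
Proof.
move=> [b Bb] AB; apply: contrapT => nAB.
have far (n : nat) : exists a, A a /\ forall y, B y -> n%:R <= mdist a y.
  (* The radius must be positive even for [n = 0], hence the added 1. *)
  apply: contrapT => nfar; apply: nAB; exists (n%:R + 1) => [|a Aa].
    exact: ltr_wpDl.
  apply: contrapT => na; apply: nfar; exists a; split=> // y By.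
  rewrite leNgt; apply/negP => ay; apply: na; apply/set_ballP.
  by exists y => //; rewrite metric_sym; lra.
have [u uP] := choice far.
have [||e closeD] := AB (range u).
- by move=> _ [n _ <-]; have [] := uP n.
- move=> [M uM].
  (* If [M] bounded the range, every [u n] would be within [M + mdist (u 0) b] of [b]; this [n]
     exceeds that value, yet [u n] is at least [n] away from [b]. *)
  pose n := (Num.truncn (M + mdist (u 0%N) b)).+1.
  have := truncnS_gt (M + mdist (u 0%N) b); rewrite -/n.
  have := (uP n).2 b Bb; have := metric_triangle (u n) (u 0%N) b.
  by have := uM (u n) (u 0%N) (imageT _ _) (imageT _ _); lra.
(* A term [u k] that survives the deletion has [k >= n > e], so no point of [B] is within [e] of
   it. *)
pose n := (Num.truncn e).+1.
have /set_dist_ltP[_ [y [[[k _ <-] nk] [By _] uy]]] :=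
  closeD _ (metric_bounded_prefix u n).
have nlek : (n <= k)%N.
  by rewrite leqNgt; apply/negP => kn; apply: nk; exists k.
have := truncnS_gt e; have := (uP k).2 y By.
by move: nlek; rewrite -(ler_nat R) -/n; lra.
Qed.

Theorem proposition6p15 (R : realType) (X : metricType R) (A B : set X)
    (hA : A !=set0) (hB : B !=set0) :
  weak_asymptotic_resemblance A B <-> (hausdorff_dist A B < +oo)%E.
Proof.
split=> [[AB BA]|/hausdorff_dist_ltyP[e [e0 AB BA]]].
- have [e e0 Ae] := coarsely_close_sub_set_ball hB BA.
  have [|f f0 Bf] := @coarsely_close_sub_set_ball _ _ B A hA.
    by move=> B' B'B nB'; exact/coarsely_closeC/AB.
  (* One radius must serve both inclusions; the sum dominates [e] and [f]. *)
  apply/hausdorff_dist_ltyP; exists (e + f); split; first exact: addr_gt0.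
  + by apply: subset_trans Ae _; apply: set_ball_le; rewrite lerDl ltW.
  + by apply: subset_trans Bf _; apply: set_ball_le; rewrite lerDr ltW.
- split=> [B' B'B nB'|A' A'A nA'].
  + exact: (coarsely_close_unbounded e0 BA).
  + by apply: coarsely_closeC; exact: (coarsely_close_unbounded e0 AB).
Qed.
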